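(* Let $G$ and $G'$ be weighted directed graphs on the same vertex set $V$, and let $S\subseteq V$ be a set of initially blue vertices. Assume $G'$ is obtained from $G$ by increasing the weights on some directed edges $(u,w)$ with $u\in S$; that is, writing $W_H(x,w)$ for the weight of $(x,w)$ in $H$, we have $W_{G'}(u,w)\ge W_G(u,w)$ for all $u\in S$, $w\in V$, and $W_{G'}(x,w)=W_G(x,w)$ for all $x\in V\setminus S$, $w\in V$. Then $\operatorname{ept}_{\mathrm{rzf}}(G,S)\ge \operatorname{ept}_{\mathrm{rzf}}(G',S)$.
   Context: Weights are nonnegative, and $W_H(x,w)=0$ if there is no edge $(x,w)$ in $H$; graphs are finite. Randomized zero forcing (RZF) on a weighted directed graph $H$: start with blue set $B_0=S$. Given the blue set $B_t$, each white vertex $w\notin B_t$ independently becomes blue at round $t+1$ with probability $p_t(w)=\frac{\sum_{u\in B_t}W_H(u,w)}{\sum_{u\in V}W_H(u,w)}$ if the denominator is positive, and $p_t(w)=0$ otherwise; blue vertices stay blue forever. Expected propagation time: if it is possible (with positive probability) to color all of $H$ blue starting from $S$, then $\operatorname{ept}_{\mathrm{rzf}}(H,S)$ is the expected value of $\tau=\min\{t: B_t=V\}$; otherwise $\operatorname{ept}_{\mathrm{rzf}}(H,S)=\infty$. The inequality is between elements of $[0,\infty]$. *)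

(* Defs.v *)
From HB Require Import structures.
From mathcomp Require Import all_boot all_order all_algebra.
From mathcomp Require Import all_classical all_reals all_analysis.

Set Implicit Arguments.
Unset Strict Implicit.
Unset Printing Implicit Defensive.
Import Order.TTheory GRing.Theory Num.Theory.

Local Open Scope classical_set_scope.
Local Open Scope ring_scope.

(* [weight H u w] is W_H(u, w); a non-edge is encoded by weight 0. *)
Record wdigraph (R : realType) (V : finType) := WDigraph {
  weight :> V -> V -> R;
  weight_ge0 : forall u w, 0 <= weight u w }.

Definition force_prob (R : realType) (V : finType) (H : wdigraph R V)
    (B : {set V}) (w : V) : R :=
  if 0 < \sum_u H u w then (\sum_(u in B) H u w) / (\sum_u H u w) else 0.

(* Probability that the next blue set is [C] when the current one is [B]: the
   vertices of [B] stay blue, and the white vertices turn blue independently,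
   whence the product. *)
Definition rzf_step (R : realType) (V : finType) (H : wdigraph R V)
    (B C : {set V}) : R :=
  if B \subset C then
    \prod_(w in ~: B)
      (if w \in C then force_prob H B w else 1 - force_prob H B w)
  else 0.

(* [B t] is the random blue set after round [t]. The last field gives the
   conditional law of [B t.+1] given the whole history [B 0, ..., B t],
   multiplied out so that histories of probability 0 need no special case. *)
Record rzf_process (R : realType) (V : finType) (H : wdigraph R V)
    (S : {set V}) (d : measure_display) (T : measurableType d)
    (P : probability T R) (B : nat -> T -> {set V}) : Prop := RZFProcess {
  rzf_measurable : forall t C, measurable [set x | B t x = C];
  rzf_init : forall x, B 0%N x = S;
  rzf_next : forall t (b : nat -> {set V}),
    P [set x | forall s, (s <= t.+1)%N -> B s x = b s] =
    (P [set x | forall s, (s <= t)%N -> B s x = b s] *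
     (rzf_step H (b t) (b t.+1))%:E)%E }.

(* The infimum is +oo at outcomes where the graph never becomes all blue. *)
Definition prop_time (R : realType) (V : finType) (T : Type)
    (B : nat -> T -> {set V}) (x : T) : \bar R :=
  ereal_inf [set t%:R%:E | t in [set t : nat | B t x = [set: V]%SET]].

(* This depends on [P] and [B] only through the law of the process, which
   [rzf_process H S P B] determines. *)
Definition ept_rzf (R : realType) (V : finType) (d : measure_display)
    (T : measurableType d) (P : probability T R) (B : nat -> T -> {set V}) :
    \bar R :=
  if (0 < P [set x | exists t, B t x = [set: V]%SET])%E
  then (\int[P]_x prop_time R B x)%E
  else +oo%E.

(* Main.v *)
Require Import Defs.
From HB Require Import structures.
From mathcomp Require Import all_boot all_order all_algebra.
From mathcomp Require Import all_classical all_reals all_analysis.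
From mathcomp Require Import measurable_realfun ring lra.

(* With product-Bernoulli transitions, the probability that the graph is not
   all blue after [n] rounds, started from [B], satisfies a one-step recursion
   and decreases when [B] grows and when the forcing probabilities grow.
   Extra weight out of [S] adds the same amount to the numerator and to the
   denominator of a ratio that is at most 1, as long as [S] is blue, so it
   raises every forcing probability. The expected propagation time is the sum
   over [n] of these survival probabilities. *)

Set Implicit Arguments.
Unset Strict Implicit.
Unset Printing Implicit Defensive.
Import Order.TTheory GRing.Theory Num.Theory.

Local Open Scope classical_set_scope.
Local Open Scope ring_scope.

(** * Means of decreasing functions of a random set with independent memberships *)

Definition bernoulli_weight (R : numDomainType) (V : finType) (q : V -> R)
    (C : {set V}) : R :=
  \prod_w (if w \in C then q w else 1 - q w).

Lemma bernoulli_weight_ge0 (R : numDomainType) (V : finType) (q : V -> R)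
    (C : {set V}) :
  (forall w, 0 <= q w <= 1) -> 0 <= bernoulli_weight q C.
Proof.
move=> q01; apply: prodr_ge0 => w _.
by have /andP[q0 q1] := q01 w; case: ifP; rewrite ?subr_ge0.
Qed.

Lemma sum_set_split (R : nmodType) (V : finType) (x : V) (F : {set V} -> R) :
  \sum_C F C = \sum_(C : {set V} | x \notin C) (F C + F (x |: C)%SET).
Proof.
rewrite (bigID (fun C : {set V} => x \notin C)) /= big_split /=; congr (_ + _).
rewrite (reindex_onto (fun C => x |: C)%SET (fun C => C :\ x)%SET) /=;
  last by move=> C; rewrite negbK => xC; exact: finset.setD1K.
apply: eq_bigl => C; rewrite setU11 /=; apply/eqP/idP => [<-|xC];
  last exact: finset.setU1K.
by rewrite !inE eqxx.
Qed.

(** Each [C] avoiding [x] is paired with [x |: C]. The other coordinates give both sets the same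
    factor [m], so on each pair the two means differ by [m * ((r x - q x) * (f C - f (x |: C)))], a
    product of nonnegative factors. *)
Lemma bernoulli_mean_le1 (R : numDomainType) (V : finType) (x : V)
    (q r : V -> R) (f : {set V} -> R) :
  (forall w, w != x -> q w = r w) -> q x <= r x ->
  (forall w, 0 <= q w <= 1) ->
  (forall C D : {set V}, C \subset D -> f D <= f C) ->
  \sum_C bernoulli_weight r C * f C <= \sum_C bernoulli_weight q C * f C.
Proof.
move=> qr qx q01 anti; rewrite !(sum_set_split x); apply: ler_sum => C xC.
pose m := \prod_(w | w != x) (if w \in C then q w else 1 - q w).
have m0 : 0 <= m.
  apply: prodr_ge0 => w _.
  by have /andP[q0 q1] := q01 w; case: ifP; rewrite ?subr_ge0.
have wC p : (forall w, w != x -> q w = p w) ->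
    bernoulli_weight p C = (1 - p x) * m /\
    bernoulli_weight p (x |: C)%SET = p x * m.
  move=> qp; rewrite /bernoulli_weight; split; rewrite (bigD1 x) //=.
    rewrite (negPf xC); congr (_ * _).
    by apply: eq_bigr => w wx; rewrite qp.
  rewrite finset.setU11; congr (_ * _).
  by apply: eq_bigr => w wx; rewrite !inE (negPf wx) qp.
have [-> ->] := wC r qr; have [-> ->] := wC q (fun _ _ => erefl).
have fC : f (x |: C)%SET <= f C by apply: anti; rewrite finset.subsetUr.
rewrite -subr_ge0 (_ : _ - _ = m * ((r x - q x) * (f C - f (x |: C)%SET))).
  by rewrite !mulr_ge0 // subr_ge0.
by ring.
Qed.

(** The parameters are changed from [q] to [r] one vertex at a time along [enum V]; each change can
    only lower the mean. *)
Lemma bernoulli_mean_le (R : numDomainType) (V : finType) (q r : V -> R)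
    (f : {set V} -> R) :
  (forall w, 0 <= q w) -> (forall w, q w <= r w) -> (forall w, r w <= 1) ->
  (forall C D : {set V}, C \subset D -> f D <= f C) ->
  \sum_C bernoulli_weight r C * f C <= \sum_C bernoulli_weight q C * f C.
Proof.
move=> q0 qr r1 anti; pose p (s : seq V) w := if w \in s then r w else q w.
have -> : r = p (enum V) by apply/funext => w; rewrite /p mem_enum.
elim: (enum V) => [|x s IH]; first by rewrite (_ : p [::] = q).
apply: le_trans IH; apply: (@bernoulli_mean_le1 _ _ x) => //.
- by move=> w wx; rewrite /p inE (negPf wx).
- by rewrite /p mem_head; case: ifP.
- move=> w; rewrite /p; case: ifP => _; last by rewrite q0 (le_trans (qr w)).
  by rewrite r1 (le_trans (q0 w)).
Qed.

(** * The transition law and the monotonicity of the forcing probabilities *)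

Definition blue_prob (R : realType) (V : finType) (H : wdigraph R V)
    (B : {set V}) (w : V) : R :=
  if w \in B then 1 else force_prob H B w.

(** Giving blue vertices success probability 1 lets the product run over all of [V]: if [C] misses a
    vertex of [B], that vertex contributes the factor [1 - 1]. *)
Lemma rzf_stepE (R : realType) (V : finType) (H : wdigraph R V)
    (B C : {set V}) :
  rzf_step H B C = bernoulli_weight (blue_prob H B) C.
Proof.
rewrite /rzf_step /bernoulli_weight /blue_prob; case: ifPn => [BC|].
  rewrite [RHS](bigID (fun w => w \in B)) /= [X in _ = X * _]big1 ?mul1r;
    last by move=> w wB; rewrite (fintype.subsetP BC) // wB.
  apply: eq_big => [w|w]; rewrite ?inE // => /negPf -> //.
case/fintype.subsetPn => w wB wC; rewrite (bigD1 w) //= wB (negPf wC) subrr.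
by rewrite mul0r.
Qed.

Lemma blue_prob_itv (R : realType) (V : finType) (H : wdigraph R V)
    (B : {set V}) (w : V) :
  0 <= blue_prob H B w <= 1.
Proof.
rewrite /blue_prob /force_prob; case: ifP => _; first by rewrite ler01 lexx.
case: ifP => [s0|_]; last by rewrite ler01 lexx.
rewrite divr_ge0 ?(ltW s0) ?sumr_ge0 //=; last by move=> *; exact: weight_ge0.
rewrite ler_pdivrMr // mul1r [leRHS](bigID (mem B)) /= lerDl.
by apply: sumr_ge0 => *; exact: weight_ge0.
Qed.

(** The ratios are [a / (a + c)] and [a' / (a' + c')], the in-weight being split into its blue and
    white parts. Here [a <= a'], and [c' <= c] because vertices outside [B'] lie outside [S], where
    the weights agree. Cross-multiplied, the claim is [a * c' <= a' * c]. *)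
Lemma force_prob_le (R : realType) (V : finType) (H H' : wdigraph R V)
    (S B B' : {set V}) (w : V) :
  (forall u, u \in S -> H u w <= H' u w) ->
  (forall u, u \notin S -> H' u w = H u w) ->
  S \subset B -> B \subset B' ->
  force_prob H B w <= force_prob H' B' w.
Proof.
move=> hS hnS SB BB'; have w0 := @weight_ge0 R V.
rewrite /force_prob (bigID (mem B)) (bigID (mem B') xpredT (H'^~ w)) /=.
set a := \sum_(u in B) H u w; set c := \sum_(u | u \notin B) H u w.
set a' := \sum_(u in B') H' u w; set c' := \sum_(u | u \notin B') H' u w.
have a0 : 0 <= a by apply: sumr_ge0.
have c0' : 0 <= c' by apply: sumr_ge0.
have aa' : a <= a'.
  rewrite /a' (big_setID B) /= (finset.setIidPr BB') -[a]addr0 lerD //;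
    last by apply: sumr_ge0.
  apply: ler_sum => u _; case: (boolP (u \in S)) => [/hS //|/hnS -> //].
have cc' : c' <= c.
  rewrite /c (bigID (mem B')) /= -[c']add0r lerD ?sumr_ge0 //.
  have -> : c' = \sum_(u | (u \notin B) && (u \notin B')) H' u w.
    apply: eq_bigl => u; apply/idP/andP => [uB'|[]//]; split=> //.
    by apply: contra uB'; apply: fintype.subsetP.
  apply: ler_sum => u /andP[uB _]; rewrite hnS //.
  by apply: contra uB; apply: fintype.subsetP.
case: ifP => ac; case: ifP => ac' //.
- rewrite ler_pdivrMr // mulrAC ler_pdivlMr // !mulrDr (mulrC a' a) lerD2l.
  by rewrite ler_pM // (le_trans c0').
(* The denominator [a' + c'] is not positive here, which forces [a <= a' <= 0]. *)
- have -> : a = 0 by apply/le_anti; rewrite a0 andbT; lra.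
  by rewrite mul0r.
- by rewrite divr_ge0 ?(le_trans a0 aa') // ltW.
Qed.

Lemma blue_prob_le (R : realType) (V : finType) (H H' : wdigraph R V)
    (S B B' : {set V}) (w : V) :
  (forall u, u \in S -> H u w <= H' u w) ->
  (forall u, u \notin S -> H' u w = H u w) ->
  S \subset B -> B \subset B' ->
  blue_prob H B w <= blue_prob H' B' w.
Proof.
move=> hS hnS SB BB'; rewrite {1}/blue_prob; case: ifP => wB.
  by rewrite /blue_prob (fintype.subsetP BB').
have /andP[_] := blue_prob_itv H B w; rewrite /blue_prob wB.
by case: ifP => // _ _; exact: (force_prob_le (S := S)).
Qed.

(** * Survival probabilities and their comparison *)

Fixpoint survival (R : realType) (V : finType) (H : wdigraph R V) (n : nat)
    (B : {set V}) : R :=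
  if B == [set: V]%SET then 0
  else if n is n'.+1 then \sum_C rzf_step H B C * survival H n' C else 1.

Lemma survival_ge0 (R : realType) (V : finType) (H : wdigraph R V) (n : nat)
    (B : {set V}) : 0 <= survival H n B.
Proof.
elim: n B => [|n IH] B /=; case: ifP => // _; apply: sumr_ge0 => C _.
by rewrite mulr_ge0 // rzf_stepE bernoulli_weight_ge0 // => w;
   exact: blue_prob_itv.
Qed.

Lemma survival_antitone (R : realType) (V : finType) (H : wdigraph R V)
    (n : nat) (B C : {set V}) :
  B \subset C -> survival H n C <= survival H n B.
Proof.
elim: n B C => [|n IH] B C BC /=; case: (C =P _) => [E|/eqP CT].
- by case: ifP.
- by rewrite ifN //; apply: contra CT => /eqP BT; rewrite -finset.subTset -BT.
- exact: (survival_ge0 H n.+1 B).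
rewrite ifN; last by apply: contra CT => /eqP BT; rewrite -finset.subTset -BT.
under [leLHS]eq_bigr do rewrite rzf_stepE.
under [leRHS]eq_bigr do rewrite rzf_stepE.
apply: bernoulli_mean_le => [w|w|w|].
- by case/andP: (blue_prob_itv H B w).
(* With a single graph no weight changes, so the empty set can serve as [S]. *)
- by apply: (@blue_prob_le _ _ H H finset.set0) => //; exact: finset.sub0set.
- by case/andP: (blue_prob_itv H C w).
- exact: IH.
Qed.

(** Two changes are made in turn: first the later survival function under the step law of [H'], by
    induction, then the step law itself, by antitonicity of [survival H n]. *)
Lemma survival_le (R : realType) (V : finType) (H H' : wdigraph R V)
    (S : {set V}) (n : nat) (B : {set V}) :
  (forall u w, u \in S -> H u w <= H' u w) ->
  (forall u w, u \notin S -> H' u w = H u w) ->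
  S \subset B -> survival H' n B <= survival H n B.
Proof.
move=> hS hnS; elim: n B => [|n IH] B SB //=; case: ifP => // _.
apply: (@le_trans _ _ (\sum_C rzf_step H' B C * survival H n C)).
  (* Only sets [C] containing [B] carry weight, so [S] stays blue and the induction hypothesis
     applies. *)
  apply: ler_sum => C _; have [BC|BC] := boolP (B \subset C); last first.
    by rewrite /rzf_step (negPf BC) !mul0r.
  apply: ler_wpM2l; last by apply: IH; exact: fintype.subset_trans BC.
  by rewrite rzf_stepE bernoulli_weight_ge0 // => w; exact: blue_prob_itv.
under [leLHS]eq_bigr do rewrite rzf_stepE.
under [leRHS]eq_bigr do rewrite rzf_stepE.
apply: bernoulli_mean_le => [w|w|w|].
- by case/andP: (blue_prob_itv H B w).
- by apply: (@blue_prob_le _ _ H H' S) => // u; [exact: hS|exact: hnS].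
- by case/andP: (blue_prob_itv H' B w).
- exact: survival_antitone.
Qed.

(** * Survival probabilities of an actual process *)

(** The event that the propagation time exceeds [t]. Every round up to [t] is tested because a
    process has increasing blue sets only almost surely, while the series for [prop_time] is to hold
    at every outcome. *)
Definition unfinished (V : finType) (T : Type) (B : nat -> T -> {set V})
    (t : nat) : set T :=
  [set x | forall s, (s <= t)%N -> B s x <> [set: V]%SET].

Lemma measurable_forall_nat (d : measure_display) (T : measurableType d)
    (p : pred nat) (Q : nat -> T -> Prop) :
  (forall s, measurable [set x | Q s x]) ->
  measurable [set x | forall s, p s -> Q s x].
Proof.
move=> mQ; rewrite (_ : [set x | _] =
    \bigcap_s (if p s then [set x | Q s x] else setT)).
  by apply: bigcapT_measurable => s; case: ifP.
apply/seteqP; split => x /= H s.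
  by move=> _; case: ifP => // ps; exact: H.
by move=> ps; have := H s I; rewrite ps.
Qed.

Lemma measure_fintype_split (d : measure_display) (T : measurableType d)
    (R : realType) (mu : {measure set T -> \bar R}) (I : finType)
    (f : T -> I) (A : set T) :
  measurable A -> (forall i, measurable [set x | f x = i]) ->
  mu A = (\sum_i mu (A `&` [set x | f x = i]))%E.
Proof.
move=> mA mf; have mAf i : measurable (A `&` [set x | f x = i]).
  exact: measurableI.
have {1}-> : A = \bigcup_(i in [set: I]) (A `&` [set x | f x = i]).
  apply/seteqP; split => [x Ax|x [i _ []] //].
  by exists (f x).
rewrite measure_fin_bigcup //; last first.
- apply/trivIsetP => i j _ _ /eqP ij; apply/seteqP; split => // x.
  by move=> [[_ /= fi] [_ /= fj]]; apply: ij; rewrite -fi -fj.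
- exact: finite_finset.
rewrite [RHS](@fsbig_seq _ _ _ _ (index_enum I)) ?index_enum_uniq //.
suff -> : [set` index_enum I] = [set: I] by [].
by apply/seteqP; split => // i _ /=; rewrite mem_index_enum.
Qed.

Lemma measurable_neqT (R : realType) (V : finType) (H : wdigraph R V)
    (S : {set V}) (d : measure_display) (T : measurableType d)
    (P : probability T R) (B : nat -> T -> {set V})
    (hB : rzf_process H S P B) (s : nat) :
  measurable [set x | B s x <> [set: V]%SET].
Proof. by apply: measurableC; exact: (rzf_measurable hB). Qed.

Lemma measurable_unfinished (R : realType) (V : finType) (H : wdigraph R V)
    (S : {set V}) (d : measure_display) (T : measurableType d)
    (P : probability T R) (B : nat -> T -> {set V})
    (hB : rzf_process H S P B) (t : nat) :
  measurable (unfinished B t).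
Proof. by apply: measurable_forall_nat => s; exact: (measurable_neqT hB). Qed.

(** The Markov property, multiplied out to avoid conditioning on null histories. The induction on
    [n] keeps [t] and [b] general, since splitting on the value of [B t.+1] lengthens the history by
    one round. *)
Lemma history_survival (R : realType) (V : finType) (H : wdigraph R V)
    (S : {set V}) (d : measure_display) (T : measurableType d)
    (P : probability T R) (B : nat -> T -> {set V})
    (hB : rzf_process H S P B) (n t : nat) (b : nat -> {set V}) :
  P [set x | (forall s, (s <= t)%N -> B s x = b s) /\
             (forall s, (t <= s <= t + n)%N -> B s x <> [set: V]%SET)] =
  (P [set x | forall s, (s <= t)%N -> B s x = b s] *
   (survival H n (b t))%:E)%E.
Proof.
elim: n t b => [|n IH] t b /=; case: eqP => [bT|bT].
(* If [b t] is the full set, the two conditions contradict each other at round [t]. *)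
1,3: rewrite mule0 (_ : [set x | _] = set0) ?measure0 //;
  apply/seteqP; split => // x [/(_ t (leqnn t)) + /(_ t)];
  by rewrite leqnn leq_addr bT => ? /(_ isT).
- rewrite mule1; congr (P _); apply/seteqP; split => x /=; first by case.
  move=> h; split=> // s; rewrite addn0 -eqn_leq => /eqP <-.
  by rewrite h.
have mh k c : measurable [set x | forall s, (s <= k)%N -> B s x = c s].
  by apply: measurable_forall_nat => s; exact: (rzf_measurable hB).
rewrite (@measure_fintype_split _ _ _ _ _ (B t.+1)); last first.
- by move=> C; exact: (rzf_measurable hB).
- apply: measurableI; first exact: mh.
  by apply: measurable_forall_nat => s; exact: (measurable_neqT hB).
(* The history [b] prolonged by the value [C] at round [t.+1]. *)
pose c C s := if s == t.+1 then C else b s.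
have cE C s : (s <= t)%N -> c C s = b s.
  by move=> st; rewrite /c ltn_eqF.
rewrite -sumEFin ge0_sume_distrr; last first.
  by move=> C _; rewrite lee_fin mulr_ge0 ?survival_ge0 // rzf_stepE
    bernoulli_weight_ge0 // => w; exact: blue_prob_itv.
apply: eq_bigr => C _; rewrite EFinM muleA.
have -> : rzf_step H (b t) C = rzf_step H (c C t) (c C t.+1).
  by rewrite cE // /c eqxx.
have -> : [set x | forall s, (s <= t)%N -> B s x = b s] =
          [set x | forall s, (s <= t)%N -> B s x = c C s].
  by apply/seteqP; split => x /= h s st; rewrite h ?cE.
rewrite -(rzf_next hB) -[X in survival H n X](_ : c C t.+1 = C); last first.
  by rewrite /c eqxx.
rewrite -IH; congr (P _); apply/seteqP; split => x /=.
  move=> [[h1 h2] h3]; split => s.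
    rewrite leq_eqVlt => /orP[/eqP -> |st]; first by rewrite /c eqxx.
    by rewrite cE // h1.
  by move=> /andP[s1 s2]; apply: h2; rewrite (ltnW s1) -addSnnS.
move=> [h1 h2]; split; last by rewrite /= h1 // /c eqxx.
have h3 s : (s <= t)%N -> B s x = b s.
  by move=> st; rewrite h1 ?(leqW st) // cE.
split => // s /andP[]; rewrite leq_eqVlt => /orP[/eqP <- _|s1 s2].
  by rewrite h3.
by apply: h2; rewrite s1 addSnnS.
Qed.

Lemma prob_unfinished (R : realType) (V : finType) (H : wdigraph R V)
    (S : {set V}) (d : measure_display) (T : measurableType d)
    (P : probability T R) (B : nat -> T -> {set V})
    (hB : rzf_process H S P B) (n : nat) :
  P (unfinished B n) = (survival H n S)%:E.
Proof.
have := history_survival hB n 0 (fun=> S); rewrite add0n.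
rewrite (_ : [set x | forall s, (s <= 0)%N -> B s x = S] = setT); last first.
  apply/seteqP; split => x //= _ s; rewrite leqn0 => /eqP ->.
  exact: (rzf_init hB).
rewrite probability_setT mul1e => <-; congr (P _).
apply/seteqP; split => x /= h; last by case: h => _.
split=> // s; rewrite leqn0 => /eqP ->; exact: (rzf_init hB).
Qed.

(** * Expected propagation time as a series *)

(** The tail-sum formula, outcome by outcome: if [m] is the first all-blue round, exactly the terms
    with [t < m] equal 1. *)
Lemma prop_time_series (R : realType) (V : finType) (T : Type)
    (B : nat -> T -> {set V}) (x : T) :
  prop_time R B x = (\sum_(t <oo) (\1_(unfinished B t) x)%:E)%E.
Proof.
have ge0 t : (0 <= (\1_(unfinished B t) x)%:E :> \bar R)%E by rewrite lee_fin.
rewrite /prop_time; have [ex|nex] := pselect (exists t, B t x == [set: V]%SET).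
  case: (ex_minnP ex) => m /eqP Bm minm.
  have A1 t : (t < m)%N -> \1_(unfinished B t) x = 1 :> R.
    move=> tm; rewrite indicE mem_set // => s st /eqP /minm.
    by rewrite leqNgt (leq_ltn_trans st tm).
  have A0 t : (m <= t)%N -> \1_(unfinished B t) x = 0 :> R.
    by move=> mt; rewrite indicE memNset // => /(_ m mt).
  transitivity (m%:R%:E : \bar R).
    apply/le_anti/andP; split.
      by apply: ereal_inf_lbound; exists m.
    apply: le_ereal_inf_tmp => _ [t /= /eqP /minm mt <-].
    by rewrite lee_fin ler_nat.
  rewrite (nneseries_split _ m) // add0n [X in (_ + X)%E]eseries0; last first.
    by move=> t mt _; rewrite A0.
  rewrite adde0 big_mkord (eq_bigr (fun=> 1%:E));
    last by move=> t _; rewrite A1.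
  by rewrite sumEFin sumr_const card_ord.
(* With no all-blue round the infimum is over the empty set, and the first [N] terms of the series
   sum to [N], beyond any real bound. *)
rewrite (_ : [set _ | _ in _] = set0); last first.
  by apply/seteqP; split => // _ [t /= Bt _]; apply: nex; exists t; apply/eqP.
rewrite ereal_inf0; apply/esym/eqyP => r r0.
have [N rN] : exists N : nat, r < N%:R.
  by exists (Num.bound r); exact: archi_boundP (ltW r0).
apply: (@le_trans _ _ (N%:R%:E)); first by rewrite lee_fin ltW.
apply: le_trans (nneseries_lim_ge N _) => //.
rewrite big_mkord (eq_bigr (fun=> 1%:E)).
  by rewrite sumEFin sumr_const card_ord.
move=> t _; rewrite indicE mem_set // => s _ Bs.
by apply: nex; exists s; apply/eqP.
Qed.

Lemma integral_prop_time (R : realType) (V : finType) (H : wdigraph R V)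
    (S : {set V}) (d : measure_display) (T : measurableType d)
    (P : probability T R) (B : nat -> T -> {set V})
    (hB : rzf_process H S P B) :
  (\int[P]_x prop_time R B x = \sum_(t <oo) (survival H t S)%:E)%E.
Proof.
under eq_integral do rewrite prop_time_series.
rewrite integral_nneseries //.
- apply: eq_eseriesr => t _; rewrite integral_indic ?setIT //.
    exact: (prob_unfinished hB).
  exact: measurable_unfinished hB t.
- move=> t; apply/measurable_EFinP; apply: measurable_indic.
  exact: measurable_unfinished hB t.
Qed.

(** The finishing event is the countable union of the complements of [unfinished B t], of
    probability [1 - survival H t S]. If all these are null, so is the union; if one is not, it
    bounds the union from below. *)
Lemma prob_finish_gt0 (R : realType) (V : finType) (H : wdigraph R V)
    (S : {set V}) (d : measure_display) (T : measurableType d)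
    (P : probability T R) (B : nat -> T -> {set V})
    (hB : rzf_process H S P B) :
  (0 < P [set x | exists t, B t x = [set: V]%SET])%E <->
  exists t, survival H t S < 1.
Proof.
have mA t := measurable_unfinished hB t.
have -> : [set x | exists t, B t x = [set: V]%SET] =
          \bigcup_t (~` unfinished B t).
  apply/seteqP; split => x /=.
    by move=> [t Bt]; exists t => // /(_ t (leqnn t)).
  by move=> [t _ /existsNP[s /not_implyP[_ /contrapT Bs]]]; exists s.
have PC t : P (~` unfinished B t) = (1 - survival H t S)%:E.
  by rewrite probability_setC // (prob_unfinished hB).
split => [P0|[t ht]].
  apply: contrapT => /forallNP h; suff P1 : P (\bigcup_t ~` unfinished B t) = 0.
    by rewrite P1 ltxx in P0.
  apply: measure_negligible.
    by apply: bigcup_measurable => k _; exact: measurableC.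
  apply: negligible_bigcup => t; apply/negligibleP; first exact: measurableC.
  apply/le_anti; rewrite measure_ge0 andbT.
  apply: (@le_trans _ _ (1 - survival H t S)%:E); first by rewrite -PC.
  by rewrite lee_fin subr_le0 leNgt; exact/negP/h.
apply: (@lt_le_trans _ _ (P (~` unfinished B t))).
  by rewrite PC lte_fin subr_gt0.
apply: le_measure; rewrite ?inE; first exact: measurableC.
  by apply: bigcup_measurable => k _; exact: measurableC.
by move=> x Ax; exists t.
Qed.

(** * Comparison of the two expected propagation times *)

Theorem corollary2p4 (R : realType) (V : finType) (G G' : wdigraph R V)
  (S : {set V})
  (hS : forall u w, u \in S -> G u w <= G' u w)
  (hnS : forall x w, x \notin S -> G' x w = G x w)
  (d : measure_display) (T : measurableType d) (P : probability T R)
  (B : nat -> T -> {set V}) (hB : rzf_process G S P B)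
  (d' : measure_display) (T' : measurableType d') (P' : probability T' R)
  (B' : nat -> T' -> {set V}) (hB' : rzf_process G' S P' B') :
  (ept_rzf P' B' <= ept_rzf P B)%E.
Proof.
have le t : survival G' t S <= survival G t S.
  by apply: (survival_le _ hS hnS); exact: fintype.subxx.
rewrite /ept_rzf; case: ifPn => [_|finish'].
  case: ifP => _; last exact: leey.
  rewrite (integral_prop_time hB) (integral_prop_time hB').
  apply: lee_nneseries => t *; rewrite lee_fin; last exact: le.
  exact: survival_ge0.
(* If [G'] almost surely never finishes, neither does [G]: some [survival G t S < 1] would give
   [survival G' t S < 1]. Both sides are then infinite. *)
rewrite ifN //; apply: contra finish' => /(prob_finish_gt0 hB)[t ht].
by apply/(prob_finish_gt0 hB'); exists t; exact: le_lt_trans ht.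
Qed.
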